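(* Let $A$ be a closed linear operator in a real or complex Banach space $(X,\|\cdot\|)$, with domain $D(A)$, kernel $\ker A$ and range $R(A)$. (i) If $A$ has a bounded inverse $A^{-1}$ (defined on $R(A)$, which need not be all of $X$), then, for each bounded weak solution $y(\cdot)$ of the equation $y'(t)=Ay(t)$, $t\ge0$, $$\lim_{t\to\infty}\frac{1}{t}\int_0^t y(s)\,ds=0$$ in the norm of $X$, with $$\left\|\frac{1}{t}\int_0^t y(s)\,ds\right\|=\mathcal{O}\left(\frac{1}{t}\right),\quad t\to\infty.$$ (ii) If $A$ is reducibly invertible, then, for each bounded weak solution $y(\cdot)$ of the equation $y'(t)=Ay(t)$, $t\ge0$, $$\lim_{t\to\infty}\frac{1}{t}\int_0^t y(s)\,ds=Py(0)$$ in the norm of $X$, where $P$ is the projection onto $\ker A$ along $R(A)$, with $$\left\|\frac{1}{t}\int_0^t y(s)\,ds-Py(0)\right\|=\mathcal{O}\left(\frac{1}{t}\right),\quad t\to\infty.$$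
   Context: The operator $A$ is a closed linear operator $A:D(A)\subseteq X\to X$, not necessarily bounded or densely defined. A weak solution of $y'(t)=Ay(t)$, $t\ge0$, is a norm-continuous function $y:[0,\infty)\to X$ such that, for all $t\ge 0$, $\int_0^t y(s)\,ds\in D(A)$ and $y(t)=y(0)+A\int_0^t y(s)\,ds$. It is bounded if $\sup_{t\ge0}\|y(t)\|<\infty$. $A$ has a bounded inverse if $A$ is injective and $A^{-1}:R(A)\to D(A)$ is bounded, i.e. there is a constant $C\ge 0$ with $\|A^{-1}g\|\le C\|g\|$ for all $g\in R(A)$. $A$ is reducibly invertible if its range $R(A)$ is a closed subspace of $X$ and the direct sum decomposition $X=\ker A\oplus R(A)$ holds. *)

(* Defs.v *)
From Stdlib Require Import Reals ClassicalEpsilon.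
From Coquelicot Require Export Coquelicot.
Open Scope R_scope.

Inductive scalar_kind := real_scalars | complex_scalars.

Definition scalar_field (k : scalar_kind) : AbsRing :=
  match k with real_scalars => R_AbsRing | complex_scalars => C_AbsRing end.

Definition of_real (k : scalar_kind) : R -> scalar_field k :=
  match k with real_scalars => fun r => r | complex_scalars => RtoC end.

Lemma of_real_plus (k : scalar_kind) (r s : R) :
  of_real k (r + s) = plus (of_real k r) (of_real k s).
Proof. destruct k; [reflexivity | exact (RtoC_plus r s)]. Qed.

Lemma of_real_mult (k : scalar_kind) (r s : R) :
  of_real k (r * s) = mult (of_real k r) (of_real k s).
Proof. destruct k; [reflexivity | exact (RtoC_mult r s)]. Qed.

Lemma of_real_one (k : scalar_kind) : of_real k 1 = one.
Proof. destruct k; reflexivity. Qed.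

Lemma abs_of_real (k : scalar_kind) (r : R) : abs (of_real k r) = Rabs r.
Proof. destruct k; [reflexivity | exact (Cmod_R r)]. Qed.

(* Coquelicot's integral takes values in Banach spaces over R only, so a function
   with values in a complex Banach space is integrated in the underlying real one,
   which has the same points, addition, topology and norm. *)
Section RestrictScalars.
Variable k : scalar_kind.
Variable X : CompleteNormedModule (scalar_field k).

Definition real_scal (r : R) (x : X) : X := scal (of_real k r) x.

Lemma real_scal_assoc (r s : R) (x : X) :
  real_scal r (real_scal s x) = real_scal (mult r s) x.
Proof.
  unfold real_scal; rewrite scal_assoc; f_equal.
  symmetry; apply of_real_mult.
Qed.

Lemma real_scal_one (x : X) : real_scal one x = x.
Proof.
  unfold real_scal; change (@one R_Ring) with 1.
  rewrite of_real_one; apply scal_one.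
Qed.

Lemma real_scal_distr_l (r : R) (x y : X) :
  real_scal r (plus x y) = plus (real_scal r x) (real_scal r y).
Proof. exact (scal_distr_l (of_real k r) x y). Qed.

Lemma real_scal_distr_r (r s : R) (x : X) :
  real_scal (plus r s) x = plus (real_scal r x) (real_scal s x).
Proof.
  unfold real_scal; change (plus r s) with (r + s).
  rewrite of_real_plus; exact (scal_distr_r (of_real k r) (of_real k s) x).
Qed.

Definition real_ModuleSpace_mixin : ModuleSpace.mixin_of R_Ring X :=
  ModuleSpace.Mixin R_Ring X real_scal
    real_scal_assoc real_scal_one real_scal_distr_l real_scal_distr_r.

Definition real_ModuleSpace_class : ModuleSpace.class_of R_Ring X :=
  ModuleSpace.Class R_Ring X
    (AbelianGroup.class (CompleteNormedModule.AbelianGroup _ X))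
    real_ModuleSpace_mixin.

Definition real_NormedModuleAux_class : NormedModuleAux.class_of R_AbsRing X :=
  NormedModuleAux.Class R_AbsRing X real_ModuleSpace_class
    (UniformSpace.class (CompleteNormedModule.UniformSpace _ X)).

Definition real_NormedModuleAux : NormedModuleAux R_AbsRing :=
  NormedModuleAux.Pack R_AbsRing X real_NormedModuleAux_class X.

Lemma norm_real_scal (r : R) (x : X) : norm (real_scal r x) <= Rabs r * norm x.
Proof. rewrite <- (abs_of_real k); exact (norm_scal (of_real k r) x). Qed.

Definition real_NormedModule_mixin :
    NormedModule.mixin_of R_AbsRing real_NormedModuleAux :=
  NormedModule.Mixin R_AbsRing real_NormedModuleAux
    (@norm _ X) (@norm_factor _ X)
    (@norm_triangle _ X) norm_real_scal
    (@norm_compat1 _ X) (@norm_compat2 _ X) (@norm_eq_zero _ X).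

Definition real_NormedModule_class : NormedModule.class_of R_AbsRing X :=
  NormedModule.Class R_AbsRing X real_NormedModuleAux_class
    real_NormedModule_mixin.

Definition restrict_scalars : CompleteNormedModule R_AbsRing :=
  CompleteNormedModule.Pack R_AbsRing X
    (CompleteNormedModule.Class R_AbsRing X real_NormedModule_class
       (CompleteNormedModule.mixin _ _
          (CompleteNormedModule.class (scalar_field k) X))) X.

End RestrictScalars.

Definition integral {k : scalar_kind} {X : CompleteNormedModule (scalar_field k)}
    (y : R -> X) (a b : R) : X :=
  @RInt (restrict_scalars k X) y a b.

Definition time_average {k : scalar_kind}
    {X : CompleteNormedModule (scalar_field k)} (y : R -> X) (t : R) : X :=
  scal (of_real k (/ t)) (integral y 0 t).

(* The values of op outside dom carry no meaning and are never used. *)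
Record linear_operator {K : AbsRing} (X : NormedModule K) := {
  dom : X -> Prop;
  op : X -> X;
  dom_zero : dom zero;
  dom_plus : forall u v, dom u -> dom v -> dom (plus u v);
  dom_scal : forall (a : K) u, dom u -> dom (scal a u);
  op_plus : forall u v, dom u -> dom v -> op (plus u v) = plus (op u) (op v);
  op_scal : forall (a : K) u, dom u -> op (scal a u) = scal a (op u)
}.
Arguments dom {K X} _ _.
Arguments op {K X} _ _.

Section Operators.
Context {K : AbsRing} {X : NormedModule K}.
Implicit Type A : linear_operator X.

Definition closed_operator A : Prop :=
  closed (fun p : X * X => dom A (fst p) /\ snd p = op A (fst p)).

Definition kernel A (u : X) : Prop := dom A u /\ op A u = zero.

Definition range A (g : X) : Prop := exists u, dom A u /\ op A u = g.

Definition injective_operator A : Prop :=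
  forall u v, dom A u -> dom A v -> op A u = op A v -> u = v.

(* The inverse R(A) -> D(A) is a total function read only on R(A). *)
Definition is_inverse A (Ainv : X -> X) : Prop :=
  forall g, range A g -> dom A (Ainv g) /\ op A (Ainv g) = g.

Definition has_bounded_inverse A : Prop :=
  injective_operator A /\
  exists Ainv : X -> X, is_inverse A Ainv /\
    exists C : R, 0 <= C /\ forall g, range A g -> norm (Ainv g) <= C * norm g.

Definition direct_sum (M N : X -> Prop) : Prop :=
  (forall x, exists u v, M u /\ N v /\ x = plus u v) /\
  (forall x, M x -> N x -> x = zero).

Definition reducibly_invertible A : Prop :=
  closed (range A) /\ direct_sum (kernel A) (range A).

Definition is_projection_along (M N : X -> Prop) (P : X -> X) : Prop :=
  forall x, M (P x) /\ N (minus x (P x)).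

Lemma projection_along_exists (M N : X -> Prop) :
  direct_sum M N -> exists P : X -> X, is_projection_along M N P.
Proof.
  intros [H _].
  assert (H' : forall x, exists u, M u /\ N (minus x u)).
  { intros x; destruct (H x) as [u [v [Mu [Nv ->]]]]; exists u; split; auto.
    replace (minus (plus u v) u) with v; auto.
    transitivity (plus v (minus u u)).
    - rewrite minus_eq_zero; symmetry; apply plus_zero_r.
    - unfold minus; rewrite plus_assoc, (plus_comm u v); reflexivity. }
  exists (fun x => proj1_sig (constructive_indefinite_description _ (H' x))).
  intros x; exact (proj2_sig (constructive_indefinite_description _ (H' x))).
Qed.

End Operators.

(* A function on [0, oo) is given by a function on R whose values at negative
   times are never used; in particular continuity at 0 is from the right. *)
Definition weak_solution {k : scalar_kind}
    {X : CompleteNormedModule (scalar_field k)} (A : linear_operator X)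
    (y : R -> X) : Prop :=
  continuous_on (fun t => 0 <= t) y /\
  forall t, 0 <= t ->
    dom A (integral y 0 t) /\ y t = plus (y 0) (op A (integral y 0 t)).

Definition bounded_on_half_line {K : AbsRing} {X : NormedModule K}
    (y : R -> X) : Prop :=
  exists M : R, forall t, 0 <= t -> norm (y t) <= M.

Definition bigO_at_infinity (f g : R -> R) : Prop :=
  exists C : R, Rbar_locally p_infty (fun t => Rabs (f t) <= C * Rabs (g t)).

(* Main.v *)
Require Import Defs.
From Stdlib Require Import ssreflect Reals Lra Lia ClassicalEpsilon.
From Coquelicot Require Import Coquelicot.
Open Scope R_scope.

(** Write I(t) for the integral of y over [0,t].  The equation of a weak solution
    says A I(t) = y(t) - y(0), and this stays bounded when y does.  So as soon as
    A is bounded below on the vectors concerned, the integrals themselves stay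
    bounded, and dividing by t gives both the limit and its rate
    ([average_rate]).

    In (i) the lower bound on A is the hypothesis, and it applies to I(t)
    directly.

    In (ii) put p = P y(0), which lies in the kernel, and let
    w(t) = I(t) - t p.  Then A w(t) = A I(t) is bounded again.  Moreover w(t) is
    the integral of y(s) - p, and every value
    y(s) - p = (y(s) - y(0)) + (y(0) - p) lies in R(A); since R(A) is a closed
    subspace, w(t) lies in R(A) as well ([integral_minus_in_range]).  It remains
    that A is bounded below on D(A) /\ R(A) ([bounded_below_on_range]).  There A
    is injective because ker A meets R(A) only in zero, and it is onto R(A)
    because the kernel component of a preimage can be discarded.  Its inverse is
    therefore a closed operator whose domain is the closed subspace R(A), and
    the closed graph theorem bounds it ([closed_graph]).

    The closed graph theorem is proved from Baire's theorem: some set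
    {norm (T y) <= n} is dense in a ball of the domain, so every y is
    approximated to relative error 1/2 by some z with norm (T z) controlled by
    norm y; iterating on the error y - z writes y as a series whose image under
    T converges absolutely, and closedness identifies the sum of the images
    with T y.

    None of this sees complex scalars, so the complex case is the real one
    applied to the underlying real space ([restrict_operator]). *)

(** * Differences, norms and limits *)

Section Differences.
Context {G : AbelianGroup}.
Implicit Types a b c : G.

Lemma minusE a b : minus a b = plus a (opp b).
Proof. reflexivity. Qed.

Lemma minus_plus_cancel a b : plus (minus a b) b = a.
Proof.
  rewrite !minusE -plus_assoc plus_opp_l; apply plus_zero_r.
Qed.

Lemma plus_minus_cancel a b : minus (plus a b) b = a.
Proof.
  rewrite !minusE -plus_assoc plus_opp_r; apply plus_zero_r.
Qed.

Lemma minus_minus_cancel_r a b c : minus (minus a c) (minus b c) = minus a b.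
Proof.
  now rewrite (minus_trans c a b) minusE opp_minus.
Qed.

Lemma minus_minus_cancel_l a b c : minus (minus a b) (minus a c) = minus c b.
Proof.
  rewrite minusE opp_minus plus_comm; symmetry; exact (minus_trans _ _ _).
Qed.

Lemma minus_minus_self a b : minus a (minus a b) = b.
Proof.
  rewrite -{2}(plus_minus_cancel b (minus a b)).
  now rewrite plus_comm minus_plus_cancel.
Qed.

Lemma minus_minus_comm a b c : minus (minus a b) c = minus (minus a c) b.
Proof.
  rewrite !minusE -!plus_assoc; f_equal; apply plus_comm.
Qed.

Lemma minus_plus_r a b c : minus a (plus b c) = minus (minus a c) b.
Proof.
  now rewrite !minusE opp_plus (plus_comm (opp b)) plus_assoc.
Qed.

End Differences.

Section NormLimits.
Context {K : AbsRing} {V : NormedModule K}.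

Lemma norm_minus_sym (x y : V) : norm (minus x y) = norm (minus y x).
Proof. now rewrite -opp_minus norm_opp. Qed.

Lemma norm_minus_le (x y : V) : norm (minus x y) <= norm x + norm y.
Proof.
  rewrite !minusE -(norm_opp y); apply norm_triangle.
Qed.

Lemma norm_minus_trans (z x y : V) :
  norm (minus x y) <= norm (minus x z) + norm (minus z y).
Proof. rewrite (minus_trans z x y); exact (norm_triangle _ _). Qed.

Lemma continuous_minus_const (a x : V) :
  filterlim (fun z => minus z a) (locally x) (locally (minus x a)).
Proof.
  apply (filterlim_comp_2 (G := locally x) (H := locally (opp a))
           (fun z => z) (fun _ => opp a) plus).
  - apply filterlim_id.
  - apply filterlim_const.
  - exact (filterlim_plus x (opp a)).
Qed.

Lemma closed_ball_closed (a : V) (r : R) :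
  closed (fun x : V => norm (minus x a) <= r).
Proof.
  apply (closed_comp (fun x : V => norm (minus x a) : R_UniformSpace) (fun u => u <= r)).
  - intros x; eapply filterlim_comp.
    + apply continuous_minus_const.
    + apply filterlim_norm.
  - apply closed_le.
Qed.

Lemma filterlim_minus_norm_le {T} (F : (T -> Prop) -> Prop) {FF : Filter F}
    (f : T -> V) (l : V) (g : T -> R) :
  F (fun t => norm (minus (f t) l) <= g t) ->
  filterlim g F (locally 0) -> filterlim f F (locally l).
Proof.
  intros Hfg Hg; apply filterlim_locally_ball_norm; intros eps.
  rewrite filterlim_locally in Hg; specialize (Hg eps).
  generalize (filter_and _ _ Hfg Hg); apply filter_imp.
  intros t [H1 H2]; unfold ball_norm.
  change (Rabs (g t - 0) < eps) in H2.
  apply Rle_lt_trans with (1 := H1).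
  apply Rle_lt_trans with (2 := H2).
  rewrite Rminus_0_r; apply Rle_abs.
Qed.

End NormLimits.

Section Completeness.
Context {K : AbsRing} {X : CompleteNormedModule K}.

Lemma halving_le_geometric (r : nat -> R) (n : nat) :
  (forall n, r (S n) <= r n / 2) -> r n <= r O * (1 / 2) ^ n.
Proof.
  intros Hr; induction n as [|n IH]; simpl; [lra|].
  specialize (Hr n); lra.
Qed.

(** The single completeness argument behind both Baire's theorem, where r bounds
    the radii of nested balls, and the closed graph theorem, where r bounds the
    images of successive errors.  The distance to the limit is at most r n
    because the remaining increments add up to at most
    (r n + r (n+1) + ...) / 2 <= r n. *)
Lemma halving_increments_converge (x : nat -> X) (r : nat -> R) :
  (forall n, norm (minus (x (S n)) (x n)) <= r n / 2) ->
  (forall n, r (S n) <= r n / 2) ->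
  exists l, filterlim x eventually (locally l) /\
    forall n, norm (minus l (x n)) <= r n.
Proof.
  intros Hx Hr.
  assert (r0 : forall n, 0 <= r n).
  { intros n; generalize (norm_ge_0 (minus (x (S n)) (x n))) (Hx n); lra. }
  assert (Hlim : exists l, filterlim x eventually (locally l)).
  { destruct (ex_series_le (fun n => minus (x (S n)) (x n))
               (fun n => scal (r O) ((1 / 2) ^ n))) as [l Hl].
    - intros n; apply Rle_trans with (1 := Hx n).
      generalize (halving_le_geometric r n Hr) (r0 n).
      change (scal (r O) ((1 / 2) ^ n)) with (r O * (1 / 2) ^ n); lra.
    - apply (ex_series_scal (K := R_AbsRing) (V := R_NormedModule)), ex_series_geom.
      rewrite Rabs_pos_eq; lra.
    - exists (plus l (x O)).
      assert (Hs : forall n,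
        sum_n (fun n => minus (x (S n)) (x n)) n = minus (x (S n)) (x O)).
      { induction n as [|n IH]; [apply sum_O|].
        rewrite sum_Sn IH plus_comm; symmetry; exact (minus_trans _ _ _). }
      refine (proj2 (filterlim_locally_ball_norm (U := X) x _) _); intros eps.
      generalize (proj1 (filterlim_locally_ball_norm (U := X) _ _) Hl eps).
      intros [N HN]; exists (S N); intros [|n] Hn; [lia|].
      specialize (HN n ltac:(lia)); unfold ball_norm in *; rewrite Hs in HN.
      rewrite minus_plus_r; exact HN. }
  destruct Hlim as [l Hl]; exists l; split; [exact Hl|].
  intros n.
  (* Since r (S m) <= r m / 2, also r m / 2 <= r m - r (S m), which telescopes. *)
  assert (Hk : forall k, norm (minus (x (n + k)%nat) (x n)) <= r n - r (n + k)%nat).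
  { induction k as [|k IH].
    - rewrite Nat.add_0_r minus_eq_zero norm_zero; lra.
    - rewrite Nat.add_succ_r.
      eapply Rle_trans; [exact (norm_minus_trans (x (n + k)%nat) (x (S (n + k))) (x n))|].
      eapply Rle_trans; [apply Rplus_le_compat; [apply Hx | exact IH]|].
      generalize (Hr (n + k)%nat); lra. }
  refine (closed_filterlim_loc x _ l Hl _ (closed_ball_closed (x n) (r n))).
  exists n; intros m Hm.
  replace m with (n + (m - n))%nat by lia.
  eapply Rle_trans; [apply Hk|].
  specialize (r0 (n + (m - n))%nat); lra.
Qed.

(** Baire's theorem relative to a closed set Y, which is how it is applied to the
    domain of an operator.  If no F n were dense in a ball of Y, every ball of Y
    would contain a ball of at most half the radius that misses F n; the centres
    of such nested balls converge to a point of Y outside every F n. *)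
Lemma baire_closed_set (Y : X -> Prop) (F : nat -> X -> Prop) (x0 : X) :
  closed Y -> Y x0 -> (forall y, Y y -> exists n, F n y) ->
  exists n c r, Y c /\ 0 < r /\
    forall y, Y y -> norm (minus y c) < r ->
    forall eps, 0 < eps ->
    exists z, Y z /\ F n z /\ norm (minus z y) < eps.
Proof.
  intros clY Yx0 cover; apply NNPP; intros Hno.
  set (ball_ok := fun s : X * R => Y (fst s) /\ 0 < snd s).
  assert (step : forall n (s : X * R), exists s' : X * R, ball_ok s ->
    ball_ok s' /\ norm (minus (fst s') (fst s)) <= snd s / 2 /\
    snd s' <= snd s / 2 /\
    forall z, Y z -> norm (minus z (fst s')) <= snd s' -> ~ F n z).
  { intros n [c r].
    destruct (excluded_middle_informative (ball_ok (c, r))) as [[Yc rpos]|Hn];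
      [|exists (c, r); intros H; contradiction].
    simpl in Yc, rpos.
    apply NNPP; intros Hs; apply Hno; exists n, c, (r / 2).
    split; [exact Yc|]; split; [lra|].
    intros y Yy Hy eps He; apply NNPP; intros Hz; apply Hs.
    (* Halving eps makes the closed ball fit into the open ball missing F n. *)
    exists (y, Rmin (eps / 2) (r / 2)); intros _; simpl.
    assert (Rmin (eps / 2) (r / 2) <= eps / 2) by apply Rmin_l.
    assert (Rmin (eps / 2) (r / 2) <= r / 2) by apply Rmin_r.
    assert (0 < Rmin (eps / 2) (r / 2)) by (apply Rmin_glb_lt; lra).
    repeat split; simpl; try assumption; try lra.
    intros z Yz Hzy Fz; apply Hz; exists z; repeat split; try assumption; lra. }
  set (next := fun n s => proj1_sig (constructive_indefinite_description _ (step n s))).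
  assert (next_spec : forall n s, ball_ok s ->
    ball_ok (next n s) /\ norm (minus (fst (next n s)) (fst s)) <= snd s / 2 /\
    snd (next n s) <= snd s / 2 /\
    forall z, Y z -> norm (minus z (fst (next n s))) <= snd (next n s) -> ~ F n z).
  { intros n s; exact (proj2_sig (constructive_indefinite_description _ (step n s))). }
  set (balls := fix balls n :=
    match n with O => (x0, 1) | S m => next m (balls m) end).
  assert (balls_ok : forall n, ball_ok (balls n)).
  { induction n as [|n IH]; [split; simpl; [exact Yx0 | lra]|].
    exact (proj1 (next_spec n _ IH)). }
  destruct (halving_increments_converge (fun n => fst (balls n))
              (fun n => snd (balls n))) as [l [Hl Hdist]].
  - intros n; exact (proj1 (proj2 (next_spec n _ (balls_ok n)))).
  - intros n; exact (proj1 (proj2 (proj2 (next_spec n _ (balls_ok n))))).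
  - assert (Yl : Y l).
    { refine (closed_filterlim _ _ l Hl _ clY).
      intros n; exact (proj1 (balls_ok n)). }
    destruct (cover l Yl) as [n Fn].
    exact (proj2 (proj2 (proj2 (next_spec n _ (balls_ok n)))) l Yl (Hdist (S n)) Fn).
Qed.

End Completeness.

(** * The closed graph theorem *)

Section OperatorDifferences.
Context {K : AbsRing} {X : NormedModule K}.

Lemma dom_minus (A : linear_operator X) u v :
  dom A u -> dom A v -> dom A (minus u v).
Proof.
  intros Hu Hv; rewrite !minusE -scal_opp_one.
  now apply dom_plus; [|apply dom_scal].
Qed.

Lemma op_minus (A : linear_operator X) u v :
  dom A u -> dom A v -> op A (minus u v) = minus (op A u) (op A v).
Proof.
  intros Hu Hv; rewrite !minusE -(scal_opp_one v) -(scal_opp_one (op A v)).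
  rewrite op_plus ?op_scal //; now apply dom_scal.
Qed.

Lemma op_zero (A : linear_operator X) : op A zero = zero.
Proof.
  transitivity (op A (minus zero zero)); [now rewrite minus_eq_zero|].
  rewrite op_minus; try apply dom_zero.
  exact (minus_eq_zero (op A zero)).
Qed.

Lemma range_plus (A : linear_operator X) g h :
  range A g -> range A h -> range A (plus g h).
Proof.
  intros [u [Hu <-]] [v [Hv <-]]; exists (plus u v).
  split; [now apply dom_plus | now apply op_plus].
Qed.

Lemma range_scal (A : linear_operator X) a g :
  range A g -> range A (scal a g).
Proof.
  intros [u [Hu <-]]; exists (scal a u).
  split; [now apply dom_scal | now apply op_scal].
Qed.

Lemma range_zero (A : linear_operator X) : range A zero.
Proof. exists zero; split; [apply dom_zero | apply op_zero]. Qed.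

Lemma range_minus (A : linear_operator X) g h :
  range A g -> range A h -> range A (minus g h).
Proof.
  intros Hg Hh; rewrite !minusE -scal_opp_one.
  now apply range_plus; [|apply range_scal].
Qed.

Lemma closed_operator_lim (A : linear_operator X) (u : nat -> X) x h :
  closed_operator A -> (forall n, dom A (u n)) ->
  filterlim u eventually (locally x) ->
  filterlim (fun n => op A (u n)) eventually (locally h) ->
  dom A x /\ op A x = h.
Proof.
  intros clA Hu Hx Hh.
  assert (H : dom A x /\ h = op A x); [|destruct H; auto].
  apply (closed_filterlim (U := prod_UniformSpace X X) (F := eventually)
           (fun n => (u n, op A (u n)))
           (fun p : X * X => dom A (fst p) /\ snd p = op A (fst p)) (x, h));
    [| |exact clA].
  - apply filterlim_locally; intros eps.
    rewrite filterlim_locally in Hx; rewrite filterlim_locally in Hh.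
    generalize (filter_and _ _ (Hx eps) (Hh eps)); apply filter_imp.
    intros n Hn; exact Hn.
  - intros n; simpl; auto.
Qed.

End OperatorDifferences.

Section ClosedGraph.
Context {X : CompleteNormedModule R_AbsRing}.

(** The first half of the closed graph theorem, where only category is used.  If
    {norm (T v) <= n} is dense near c, then c and c + lam y are both close to
    points of that set; the difference of these points, divided by lam,
    approximates y, and its image under T has norm at most 2 n / lam. *)
Lemma approximate_bound (T : linear_operator X) :
  closed (dom T) ->
  exists c, 0 <= c /\ forall y, dom T y -> exists z, dom T z /\
    norm (minus y z) <= norm y / 2 /\ norm (op T z) <= c * norm y.
Proof.
  intros clD.
  destruct (baire_closed_set (dom T) (fun n y => norm (op T y) <= INR n) zero clD)
    as [n [c [r [Dc [rpos Hdense]]]]].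
  - exact (dom_zero X T).
  - intros y _.
    destruct (nfloor_ex (norm (op T y)) (norm_ge_0 _)) as [n Hn].
    exists (S n); rewrite S_INR; lra.
  - exists (4 * INR n / r); split.
    { apply Rdiv_le_0_compat; [generalize (pos_INR n); lra | exact rpos]. }
    intros y Dy.
    destruct (Req_dec (norm y) 0) as [y0|y0].
    { apply norm_eq_zero in y0; subst y; exists zero; split; [exact (dom_zero X T)|].
      rewrite minus_eq_zero op_zero norm_zero; split; lra. }
    assert (ypos : 0 < norm y) by (generalize (norm_ge_0 y); lra).
    (* lam y has norm r / 2, so c + lam y is well inside the ball; errors of r / 8
       at each of the two points then give an error of norm y / 2 after division. *)
    set (lam := r / (2 * norm y)).
    assert (lampos : 0 < lam) by (apply Rdiv_lt_0_compat; lra).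
    set (w := scal (lam : R_AbsRing) y).
    assert (Hw : norm w <= lam * norm y).
    { eapply Rle_trans; [exact (norm_scal (lam : R_AbsRing) y)|].
      change (abs (lam : R_AbsRing)) with (Rabs lam).
      rewrite Rabs_pos_eq; lra. }
    assert (lamy : lam * norm y = r / 2) by (unfold lam; field; lra).
    destruct (Hdense (plus w c)) with (eps := r / 8) as [z1 [D1 [F1 H1]]].
    { apply dom_plus; [apply dom_scal|]; assumption. }
    { rewrite plus_minus_cancel; lra. }
    { lra. }
    destruct (Hdense c) with (eps := r / 8) as [z2 [D2 [F2 H2]]];
      [exact Dc | rewrite minus_eq_zero norm_zero; lra | lra |].
    assert (Hinv : forall v : X, norm (scal (/ lam : R_AbsRing) v) <= / lam * norm v).
    { intros v; eapply Rle_trans; [exact (norm_scal (/ lam : R_AbsRing) v)|].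
      change (abs (/ lam : R_AbsRing)) with (Rabs (/ lam)).
      rewrite Rabs_pos_eq; [lra | left; now apply Rinv_0_lt_compat]. }
    exists (scal (/ lam : R_AbsRing) (minus z1 z2)); split; [|split].
    + exact (dom_scal X T (/ lam) _ (dom_minus T z1 z2 D1 D2)).
    + rewrite norm_minus_sym.
      assert (Ey : y = scal (/ lam : R_AbsRing) w).
      { unfold w; rewrite scal_assoc.
        change (mult (/ lam : R_AbsRing) lam) with (/ lam * lam).
        replace (/ lam * lam) with 1 by (field; lra); symmetry; exact (scal_one y). }
      rewrite {1}Ey; rewrite -scal_minus_distr_l.
      assert (Ez : minus (minus z1 z2) w = minus (minus z1 (plus w c)) (minus z2 c)).
      { now rewrite (minus_plus_r z1 w c) (minus_minus_comm (minus z1 c))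
          minus_minus_cancel_r. }
      rewrite Ez.
      eapply Rle_trans; [apply Hinv|].
      replace (norm y / 2) with (/ lam * (r / 4)) by (unfold lam; field; lra).
      apply Rmult_le_compat_l; [left; now apply Rinv_0_lt_compat|].
      eapply Rle_trans; [apply (norm_minus_le (V := X))|].
      eapply Rle_trans; [apply Rplus_le_compat; left; [exact H1 | exact H2] | lra].
    + rewrite op_scal ?op_minus //; [|exact (dom_minus T z1 z2 D1 D2)].
      eapply Rle_trans; [apply Hinv|].
      replace (4 * INR n / r * norm y) with (/ lam * (2 * INR n))
        by (unfold lam; field; lra).
      apply Rmult_le_compat_l; [left; now apply Rinv_0_lt_compat|].
      eapply Rle_trans; [apply (norm_minus_le (V := X))|].
      eapply Rle_trans; [apply Rplus_le_compat; [exact F1 | exact F2] | lra].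
Qed.

(** Successive approximation: the errors rest n halve at each step, hence so do
    the bounds on the images of the corrections, and the factor 2 c is the sum
    of the geometric series. *)
Theorem closed_graph (T : linear_operator X) :
  closed_operator T -> closed (dom T) ->
  exists C, 0 <= C /\ forall y, dom T y -> norm (op T y) <= C * norm y.
Proof.
  intros clT clD.
  destruct (approximate_bound T clD) as [c [cpos Happrox]].
  exists (2 * c); split; [lra|]; intros y Dy.
  assert (Hex : forall v, exists z, dom T v -> dom T z /\
    norm (minus v z) <= norm v / 2 /\ norm (op T z) <= c * norm v).
  { intros v; destruct (excluded_middle_informative (dom T v)) as [Dv|Dv].
    - destruct (Happrox v Dv) as [z Hz]; exists z; auto.
    - exists v; intros H; contradiction. }
  set (f := fun v => proj1_sig (constructive_indefinite_description _ (Hex v))).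
  assert (Hf : forall v, dom T v -> dom T (f v) /\
    norm (minus v (f v)) <= norm v / 2 /\ norm (op T (f v)) <= c * norm v).
  { intros v; exact (proj2_sig (constructive_indefinite_description _ (Hex v))). }
  set (rest := fix rest n :=
    match n with O => y | S m => minus (rest m) (f (rest m)) end).
  assert (Drest : forall n, dom T (rest n)).
  { induction n as [|n IH]; [exact Dy|].
    apply dom_minus; [exact IH | now apply Hf]. }
  assert (Hrest : forall n, norm (rest (S n)) <= norm (rest n) / 2).
  { intros n; now apply (Hf (rest n)). }
  set (approx := fun n => minus y (rest n)).
  assert (Dapprox : forall n, dom T (approx n)).
  { intros n; now apply dom_minus. }
  destruct (halving_increments_converge (fun n => op T (approx n))
              (fun n => 2 * c * norm (rest n))) as [h [Hh Hdist]].
  - intros n; rewrite -op_minus //.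
    unfold approx; rewrite minus_minus_cancel_l; simpl.
    rewrite minus_minus_self.
    apply Rle_trans with (1 := proj2 (proj2 (Hf _ (Drest n)))); lra.
  - intros n; replace (2 * c * norm (rest n) / 2)
      with (2 * c * (norm (rest n) / 2)) by lra.
    apply Rmult_le_compat_l; [lra | apply Hrest].
  - destruct (closed_operator_lim T approx y h clT Dapprox) as [_ Ty].
    + apply (filterlim_minus_norm_le (V := X) eventually approx y
               (fun n => norm y * (1 / 2) ^ n)).
      * exists O; intros n _; unfold approx.
        rewrite norm_minus_sym minus_minus_self.
        exact (halving_le_geometric (fun n => norm (rest n)) n Hrest).
      * replace (locally 0) with (Rbar_locally (Rbar_mult (norm y) 0))
          by (simpl; now rewrite Rmult_0_r).
        apply is_lim_seq_scal_l, is_lim_seq_geom; rewrite Rabs_pos_eq; lra.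
    + exact Hh.
    + specialize (Hdist O); unfold approx in Hdist; simpl in Hdist.
      rewrite minus_eq_zero op_zero in Hdist.
      rewrite Ty; rewrite -(plus_zero_r h) -opp_zero; exact Hdist.
Qed.

(** The inverse S of A on D(A) /\ R(A) is a linear operator with domain R(A).  Its
    graph is the reflected graph of A cut down to the closed set R(A) of values,
    so it is closed and [closed_graph] applies. *)
Lemma bounded_below_on_range (A : linear_operator X) :
  closed_operator A -> closed (range A) ->
  direct_sum (kernel A) (range A) ->
  exists C, forall u, dom A u -> range A u -> norm u <= C * norm (op A u).
Proof.
  intros clA clR [Hdec Hint].
  assert (Huniq : forall u v, dom A u -> range A u -> dom A v -> range A v ->
    op A u = op A v -> u = v).
  { intros u v Du Ru Dv Rv E.
    rewrite -(minus_plus_cancel u v) -[RHS]plus_zero_l; f_equal.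
    apply Hint; [split; [now apply dom_minus|] | now apply range_minus].
    rewrite op_minus // E; exact (minus_eq_zero (op A v)). }
  assert (Hex : forall g, exists u, range A g ->
    dom A u /\ range A u /\ op A u = g).
  { intros g; destruct (excluded_middle_informative (range A g)) as [[u [Du Eu]]|Hg];
      [|exists g; intros H; contradiction].
    destruct (Hdec u) as [k [v [[Dk Ek] [Rv ->]]]].
    assert (Dv : dom A v).
    { rewrite -(plus_minus_cancel v k) plus_comm; now apply dom_minus. }
    exists v; intros _; split; [exact Dv|]; split; [exact Rv|].
    rewrite -Eu op_plus // Ek; symmetry; apply plus_zero_l. }
  set (S := fun g => proj1_sig (constructive_indefinite_description _ (Hex g))).
  assert (HS : forall g, range A g ->
    dom A (S g) /\ range A (S g) /\ op A (S g) = g).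
  { intros g; exact (proj2_sig (constructive_indefinite_description _ (Hex g))). }
  assert (S_plus : forall g h, range A g -> range A h ->
    S (plus g h) = plus (S g) (S h)).
  { intros g h Hg Hh.
    destruct (HS g Hg) as [D1 [R1 E1]]; destruct (HS h Hh) as [D2 [R2 E2]].
    destruct (HS _ (range_plus A g h Hg Hh)) as [D3 [R3 E3]].
    apply Huniq; auto; [now apply dom_plus | now apply range_plus |].
    rewrite op_plus // E1 E2; exact E3. }
  assert (S_scal : forall a g, range A g -> S (scal a g) = scal a (S g)).
  { intros a g Hg.
    destruct (HS g Hg) as [D1 [R1 E1]].
    destruct (HS _ (range_scal A a g Hg)) as [D3 [R3 E3]].
    apply Huniq; auto; [now apply dom_scal | now apply range_scal |].
    rewrite op_scal // E1; exact E3. }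
  set (T := Build_linear_operator _ X (range A) S (range_zero A)
    (range_plus A) (range_scal A) S_plus S_scal).
  destruct (closed_graph T) as [C [_ HC]].
  - apply closed_ext with (fun p : X * X =>
      (dom A (snd p) /\ fst p = op A (snd p)) /\ range A (snd p)).
    + intros [g u]; simpl; split.
      * intros [[Du ->] Ru]; assert (Rg : range A (op A u)) by (exists u; auto).
        split; [exact Rg|]; destruct (HS _ Rg) as [D [R' E]]; symmetry; now apply Huniq.
      * intros [Rg ->]; destruct (HS _ Rg) as [D [R' E]]; auto.
    + apply closed_and.
      * apply (closed_comp (fun p : X * X => (snd p, fst p))
          (fun p : X * X => dom A (fst p) /\ snd p = op A (fst p))); [|exact clA].
        intros p; apply filterlim_locally; intros eps; exists eps.
        intros q [H1 H2]; split; assumption.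
      * apply (closed_comp (fun p : X * X => snd p) (range A)); [|exact clR].
        intros [g u]; apply continuous_snd.
  - exact clR.
  - exists C; intros u Du Ru.
    assert (Rg : range A (op A u)) by (exists u; auto).
    replace u with (S (op A u)) at 1; [exact (HC _ Rg)|].
    destruct (HS _ Rg) as [D [R' E]]; now apply Huniq.
Qed.

End ClosedGraph.

(** * Integrals and time averages *)

Section Averages.
Context {X : CompleteNormedModule R_AbsRing}.

(** The integral is a limit of Riemann sums, which are linear combinations of
    values of f.  Requiring f t in Y for all real t, not just on [a,b], keeps
    track of no sample points. *)
Lemma is_RInt_in_closed_subspace (Y : X -> Prop) (f : R -> X) (a b : R) (I : X) :
  closed Y -> Y zero -> (forall u v, Y u -> Y v -> Y (plus u v)) ->
  (forall (c : R_AbsRing) u, Y u -> Y (scal c u)) ->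
  (forall t, Y (f t)) -> is_RInt f a b I -> Y I.
Proof.
  intros clY Y0 Yplus Yscal Yf HI.
  refine (closed_filterlim _ _ I HI _ clY).
  intros ptd; apply Yscal.
  induction ptd as [x0|h s IH] using SF_cons_ind.
  - exact Y0.
  - rewrite Riemann_sum_cons; apply Yplus; [apply (Yscal (SF_h s - fst h)), Yf | exact IH].
Qed.

(** Two-sided continuity at the endpoints is what integrability is deduced from,
    while a weak solution is continuous at 0 from the right only; freezing
    it at its initial value for negative times repairs this without changing
    the integrals over [0,t]. *)
Lemma continuous_extend_left (y : R -> X) (t : R) :
  continuous_on (fun s => 0 <= s) y -> continuous (fun s => y (Rmax 0 s)) t.
Proof.
  intros Hy P HP.
  specialize (Hy (Rmax 0 t) (Rmax_l 0 t) P HP).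
  unfold filtermap, within in *.
  assert (Hc : continuous (Rmax 0) t).
  { apply filterlim_locally; intros eps; exists eps; intros s Hs.
    change (Rabs (Rmax 0 s - Rmax 0 t) < eps).
    change (Rabs (s - t) < eps) in Hs.
    revert Hs; unfold Rmax, Rabs.
    repeat destruct Rle_dec; repeat destruct Rcase_abs; lra. }
  generalize (Hc _ Hy); unfold filtermap; apply filter_imp.
  intros s Hs; apply Hs, Rmax_l.
Qed.

Lemma is_RInt_extend_left (y : R -> X) (t : R) :
  continuous_on (fun s => 0 <= s) y -> 0 <= t ->
  is_RInt (fun s => y (Rmax 0 s)) 0 t (RInt y 0 t).
Proof.
  intros Hy Ht.
  assert (E : RInt y 0 t = RInt (fun s => y (Rmax 0 s)) 0 t).
  { apply RInt_ext; rewrite Rmin_left //; intros s Hs.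
    rewrite Rmax_right //; lra. }
  rewrite E; apply RInt_correct, ex_RInt_continuous.
  intros s _; now apply continuous_extend_left.
Qed.

(** The difference of I(t) / t and p is the bounded drift I(t) - t p divided
    by t. *)
Lemma average_rate (I : R -> X) (p : X) (B : R) :
  (forall t, 0 <= t -> norm (minus (I t) (scal (t : R_AbsRing) p)) <= B) ->
  let avg t := scal (/ t : R_AbsRing) (I t) in
  filterlim avg (Rbar_locally p_infty) (locally p) /\
  bigO_at_infinity (fun t => norm (minus (avg t) p)) (fun t => / t).
Proof.
  intros HB avg.
  assert (Hrate : forall t, 0 < t -> norm (minus (avg t) p) <= B * / t).
  { intros t Ht.
    assert (tpos : 0 < / t) by now apply Rinv_0_lt_compat.
    replace (minus (avg t) p)
      with (scal (/ t : R_AbsRing) (minus (I t) (scal (t : R_AbsRing) p))).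
    2:{ rewrite scal_minus_distr_l; unfold avg; f_equal.
        rewrite scal_assoc; change (mult (/ t : R_AbsRing) t) with (/ t * t).
        replace (/ t * t) with 1 by (field; lra); exact (scal_one p). }
    eapply Rle_trans; [exact (norm_scal (/ t : R_AbsRing) _)|].
    change (abs (/ t : R_AbsRing)) with (Rabs (/ t)).
    rewrite Rmult_comm Rabs_pos_eq; [|lra].
    apply Rmult_le_compat_r; [lra | apply HB; lra]. }
  split.
  - apply (filterlim_minus_norm_le (V := X) _ avg p (fun t => B * / t)).
    + exists 0; exact Hrate.
    + assert (H : is_lim (fun t => B * / t) p_infty (Rbar_mult B 0)).
      { apply is_lim_scal_l.
        apply (is_lim_inv (fun t => t) p_infty p_infty); [apply is_lim_id | discriminate]. }
      simpl in H; rewrite Rmult_0_r in H; exact H.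
  - exists B, 0; intros t Ht.
    rewrite !Rabs_pos_eq;
      [now apply Hrate | left; now apply Rinv_0_lt_compat | apply norm_ge_0].
Qed.

End Averages.

(** * Weak solutions *)

(** A over the underlying real space.  Domain, values, graph, kernel and range are
    unchanged, so every fact about them is shared by conversion. *)
Definition restrict_operator {k : scalar_kind}
    {X : CompleteNormedModule (scalar_field k)} (A : linear_operator X) :
    linear_operator (restrict_scalars k X) :=
  Build_linear_operator R_AbsRing (restrict_scalars k X) (dom A) (op A)
    (dom_zero X A) (dom_plus X A) (fun a => dom_scal X A (of_real k a))
    (op_plus X A) (fun a => op_scal X A (of_real k a)).

Section WeakSolutions.
Context {X : CompleteNormedModule R_AbsRing}.
Variables (A : linear_operator X) (y : R -> X) (M : R).
Hypothesis Hcont : continuous_on (fun t => 0 <= t) y.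
Hypothesis Hsol : forall t, 0 <= t ->
  dom A (RInt y 0 t) /\ y t = plus (y 0) (op A (RInt y 0 t)).
Hypothesis Hbound : forall t, 0 <= t -> norm (y t) <= M.

Lemma op_integral t : 0 <= t -> op A (RInt y 0 t) = minus (y t) (y 0).
Proof.
  intros Ht; rewrite (proj2 (Hsol t Ht)) plus_comm; symmetry.
  exact (plus_minus_cancel (op A (RInt y 0 t)) (y 0)).
Qed.

Lemma norm_op_integral_le t : 0 <= t -> norm (op A (RInt y 0 t)) <= 2 * M.
Proof.
  intros Ht; rewrite op_integral //.
  eapply Rle_trans; [apply (norm_minus_le (V := X))|].
  generalize (Hbound t Ht) (Hbound 0 (Rle_refl 0)); lra.
Qed.

(** The difference is the integral of y(s) - p, whose values all lie in the range:
    y(s) - y(0) does by the equation, y(0) - p by hypothesis. *)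
Lemma integral_minus_in_range (p : X) t :
  closed (range A) -> range A (minus (y 0) p) -> 0 <= t ->
  range A (minus (RInt y 0 t) (scal (t : R_AbsRing) p)).
Proof.
  intros clR Hp Ht.
  apply (is_RInt_in_closed_subspace (range A)
           (fun s => minus (y (Rmax 0 s)) p) 0 t).
  - exact clR.
  - exact (range_zero A).
  - exact (range_plus A).
  - exact (range_scal A).
  - intros s; destruct (Hsol _ (Rmax_l 0 s)) as [D _].
    rewrite (minus_trans (y 0)); apply (range_plus A); [|exact Hp].
    rewrite -op_integral; [|apply Rmax_l]; now exists (RInt y 0 (Rmax 0 s)).
  - apply (is_RInt_minus (V := X)); [now apply is_RInt_extend_left|].
    rewrite -{2}(Rminus_0_r t); apply (is_RInt_const (V := X)).
Qed.

(** A sends the drift to A I(t), because A p = 0, and the drift lies in the range,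
    where A is bounded below. *)
Lemma integral_drift_bounded (p : X) :
  closed_operator A -> closed (range A) -> direct_sum (kernel A) (range A) ->
  kernel A p -> range A (minus (y 0) p) ->
  exists B, forall t, 0 <= t ->
    norm (minus (RInt y 0 t) (scal (t : R_AbsRing) p)) <= B.
Proof.
  intros clA clR HD [Dp Ep] Hp.
  destruct (bounded_below_on_range A clA clR HD) as [C HC].
  exists (Rabs C * (2 * M)); intros t Ht.
  destruct (Hsol t Ht) as [D _].
  assert (Dtp : dom A (scal (t : R_AbsRing) p)) by exact (dom_scal X A t p Dp).
  eapply Rle_trans;
    [apply HC; [now apply (dom_minus A) | now apply integral_minus_in_range]|].
  rewrite op_minus // op_scal // Ep.
  rewrite (scal_zero_r (V := X)); rewrite !minusE opp_zero plus_zero_r.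
  eapply Rle_trans;
    [apply Rmult_le_compat_r; [apply norm_ge_0 | apply Rle_abs]|].
  apply Rmult_le_compat_l; [apply Rabs_pos | now apply norm_op_integral_le].
Qed.

End WeakSolutions.

Theorem theorem5p1 :
  forall (k : scalar_kind) (X : CompleteNormedModule (scalar_field k))
    (A : linear_operator X),
  closed_operator A ->
  (has_bounded_inverse A ->
   forall y : R -> X, weak_solution A y -> bounded_on_half_line y ->
     filterlim (time_average y) (Rbar_locally p_infty) (locally (zero : X)) /\
     bigO_at_infinity (fun t => norm (time_average y t)) (fun t => / t))
  /\
  (reducibly_invertible A ->
   forall P : X -> X, is_projection_along (kernel A) (range A) P ->
   forall y : R -> X, weak_solution A y -> bounded_on_half_line y ->
     filterlim (time_average y) (Rbar_locally p_infty) (locally (P (y 0))) /\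
     bigO_at_infinity (fun t => norm (minus (time_average y t) (P (y 0))))
       (fun t => / t)).
Proof.
  intros k X A clA; split.
  - intros [Hinj [Ainv [HAinv [C [Cpos HC]]]]] y [Hcont Hsol] [M HM].
    destruct (average_rate (X := restrict_scalars k X)
                (fun t => integral y 0 t) zero (C * (2 * M))) as [Hlim Hrate].
    + intros t Ht; rewrite (scal_zero_r (V := restrict_scalars k X)).
      rewrite !minusE opp_zero plus_zero_r.
      destruct (Hsol t Ht) as [D _].
      assert (Rg : range A (op A (integral y 0 t))) by (now exists (integral y 0 t)).
      replace (integral y 0 t) with (Ainv (op A (integral y 0 t))).
      2:{ destruct (HAinv _ Rg) as [D' E']; now apply Hinj. }
      eapply Rle_trans; [exact (HC _ Rg)|].
      apply Rmult_le_compat_l; [exact Cpos|].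
      exact (norm_op_integral_le (restrict_operator A) y M Hsol HM t Ht).
    + split; [exact Hlim|].
      destruct Hrate as [B [T HB]]; exists B, T; intros t Ht.
      specialize (HB t Ht); rewrite minusE opp_zero plus_zero_r in HB; exact HB.
  - intros [clR HD] P HP y [Hcont Hsol] [M HM].
    destruct (HP (y 0)) as [Hk Hr].
    destruct (integral_drift_bounded (restrict_operator A) y M Hcont Hsol HM
                (P (y 0)) clA clR HD Hk Hr) as [B HB].
    exact (average_rate (X := restrict_scalars k X)
             (fun t => integral y 0 t) (P (y 0)) B HB).
Qed.
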